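(* Let $\beta\in\mathbb C\setminus\mathbb R$ with $|\beta|>1$, and let $\mathcal A=\{-M,\dots,-1,0,1,\dots,M\}\subset\mathbb Z$. If $\beta\overline\beta+|\beta+\overline\beta|<\#\mathcal A=2M+1$, then $(\beta,\mathcal A)$ has the OL Property.
   Context: $B(x,\varepsilon)$ is the open ball of center $x$ and radius $\varepsilon$; for $T\subset\mathbb C$, $T^\varepsilon=\bigcup_{x\in T}B(x,\varepsilon)$, $T+a=\{x+a:x\in T\}$, $\beta T=\{\beta x:x\in T\}$. A pair $(\beta,\mathcal A)$ ($\beta\in\mathbb C$, $|\beta|>1$, $\mathcal A\subset\mathbb C$ finite with $0\in\mathcal A$) has the OL Property if there exist $\varepsilon>0$ and a bounded set $I\subset\mathbb C$ such that for each $x\in(\beta I)^\varepsilon$ there exists $a\in\mathcal A$ with $B(x,\varepsilon)\subset I+a$. *)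

(* Defs.v *)
(* The complex plane is R[i], for an arbitrary R : realType. *)
From HB Require Import structures.
From mathcomp Require Import all_boot all_order all_algebra.
From mathcomp Require Import finmap.
From mathcomp Require Import complex.
From mathcomp Require Import all_classical all_reals all_analysis.

Set Implicit Arguments.
Unset Strict Implicit.
Unset Printing Implicit Defensive.

Import Order.TTheory GRing.Theory Num.Theory.
Import numFieldNormedType.Exports.

Local Open Scope fset_scope.
Local Open Scope classical_set_scope.
Local Open Scope complex_scope.
Local Open Scope ring_scope.

(* The library's metric structure on R[i] lives on the regular module R[i]^o;
   its radii are elements of R[i], hence the coercion e%:C. *)
Definition disk (R : realType) (x : R[i]) (e : R) : set R[i] :=
  ball (x : R[i]^o) e%:C.

Definition fatten (R : realType) (T : set R[i]) (e : R) : set R[i] :=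
  \bigcup_(x in T) disk x e.

Definition translate (R : realType) (T : set R[i]) (a : R[i]) : set R[i] :=
  [set x + a | x in T].

Definition dilate (R : realType) (beta : R[i]) (T : set R[i]) : set R[i] :=
  [set beta * x | x in T].

(* [I] has to be required nonempty: with [I = set0] the covering condition
   would hold vacuously for every pair (beta, A). *)
Definition OL_property (R : realType) (beta : R[i]) (A : {fset R[i]}) : Prop :=
  exists (e : R) (I : set R[i]),
    [/\ 0 < e, bounded_set (I : set R[i]^o), I !=set0 &
        forall x : R[i], fatten (dilate beta I) e x ->
          exists2 a : R[i], a \in A & disk x e `<=` translate I a].

Definition digits (R : realType) (M : nat) : {fset R[i]} :=
  [fset (k%:R - M%:R : R[i]) | k : 'I_(2 * M).+1 in 'I_(2 * M).+1].

Lemma in_digits (R : realType) (M : nat) (x : R[i]) :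
  reflect (exists2 m : int, - M%:Z <= m <= M%:Z & x = m%:~R) (x \in digits R M).
Proof.
apply: (iffP (imfsetP _ _ _ _)) => /= [[k _ ->]|[m /andP[lm um] ->]].
  exists (k%:Z - M%:Z); last by rewrite rmorphB.
  have kM : (k <= M + M)%N by rewrite addnn -mul2n -ltnS.
  by rewrite lerBrDr addNr lerBlDr -PoszD !lez_nat kM.
have m0 : 0 <= m + M%:Z by rewrite -lerBlDr sub0r.
have mM : (absz (m + M%:Z)%R < (2 * M).+1)%N.
  by rewrite ltnS -lez_nat gez0_abs// mul2n -addnn PoszD lerD2r.
exists (Ordinal mM) => //=.
by rewrite -[(absz _)%:R]/((absz (m + M%:Z)%R)%:~R) gez0_abs// rmorphD addrK.
Qed.

Lemma card_digits (R : realType) (M : nat) : #|` digits R M| = (2 * M + 1)%N.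
Proof.
rewrite card_imfset/=; first by rewrite -cardE card_ord addn1.
by move=> i j /addIr/eqP; rewrite eqr_nat => /eqP/val_inj.
Qed.

Lemma in_disk (R : realType) (x y : R[i]) (e : R) :
  disk x e y <-> `|x - y| < e%:C.
Proof. by []. Qed.

Lemma bounded_setC (R : realType) (I : set R[i]) :
  bounded_set (I : set R[i]^o) <->
  exists r : R, forall z : R[i], I z -> `|z| <= r%:C.
Proof.
split=> [[B [Breal BI]]|[r rI]].
  have BE : B = (complex.Re B)%:C by apply/eqP; rewrite eq_sym RRe_real.
  exists (complex.Re B + 1) => z Iz; apply: (BI _ _ z Iz).
  by rewrite {1}BE ltcR ltrDl.
exists r%:C; split=> [|x rx z Iz]; first by apply/complex_realP; exists r.
exact: (le_trans (rI z Iz) (ltW rx)).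
Qed.

(* Main.v *)
(* Write s = beta + conj beta and n = beta * conj beta.  In the real basis
   (1, - conj beta), where z = v - y * conj beta, multiplication by beta is the
   map (v, y) |-> (s v - n y, v).  Take for I the parallelogram |v| <= 1/2 + d,
   |y| <= 1/2 + 2 d.  On beta I the new y is bounded by 1/2 + d, which leaves
   room for a small disk, and the new v is bounded by |s| (1/2 + d) +
   n (1/2 + 2 d), which stays below M + 1/2 for small d; so v is within 1/2 of
   a digit, and digits only translate v. *)
Require Import Defs.
From HB Require Import structures.
From mathcomp Require Import all_boot all_order all_algebra.
From mathcomp Require Import finmap.
From mathcomp Require Import complex.
From mathcomp Require Import all_classical all_reals all_analysis.
From mathcomp Require Import ring lra.

Set Implicit Arguments.
Unset Strict Implicit.
Unset Printing Implicit Defensive.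

Import Order.TTheory GRing.Theory Num.Theory.
Import numFieldNormedType.Exports.

Local Open Scope fset_scope.
Local Open Scope classical_set_scope.
Local Open Scope complex_scope.
Local Open Scope ring_scope.

Lemma normr_i (R : rcfType) : `|'i%C : R[i]| = 1.
Proof. by rewrite normc_def /= expr0n expr1n add0r sqrtr1. Qed.

Lemma normc_ge_Im (R : rcfType) (z : R[i]) : `|complex.Im z|%:C <= `|z|.
Proof.
have := normc_ge_Re (z * 'i%C).
by rewrite ReiNIm normrN normrM normr_i mulr1.
Qed.

Lemma normr_real (R : rcfType) (x : R) : `|x%:C| = `|x|%:C.
Proof. by rewrite normc_def /= expr0n addr0 sqrtr_sqr. Qed.

Lemma normc_le_ReIm (R : rcfType) (z : R[i]) :
  `|z| <= (`|complex.Re z| + `|complex.Im z|)%:C.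
Proof.
rewrite {1}[z]complexE rmorphD /= -!normr_real (le_trans (ler_normD _ _))//.
by rewrite normrM normr_i mul1r.
Qed.

(** Both conjugates multiply [z] to the square of its norm, and a nonzero [z] cancels. *)
Lemma conjCE (R : rcfType) (z : R[i]) : Num.conj z = conjc z.
Proof.
have [->|z0] := eqVneq z 0; first by rewrite rmorph0 conjc0.
by apply: (mulfI z0); rewrite -normCK sqr_normc.
Qed.

Lemma nearest_int (R : realType) (M : nat) (x : R) :
  `|x| < M%:R + 2^-1 ->
  exists2 m : int, - M%:Z <= m <= M%:Z & `|x - m%:~R| <= 2^-1.
Proof.
rewrite ltr_norml => /andP[xl xu].
(* Rounding by the floor of [x + 1/2]. The strict bound on [x] matters: at [x = M + 1/2] this floor
   would be [M + 1]. *)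
have fl := floor_le_tmp (x + 2^-1); have fu := floorD1_gt (x + 2^-1).
set m := Num.floor _ in fl fu; rewrite intrD in fu.
exists m; last by rewrite ler_norml; apply/andP; split; lra.
apply/andP; split; rewrite -ltzD1 -(ltr_int R) !rmorphD /= ?rmorphN /=; lra.
Qed.

Section Coordinates.
Variables (R : realType) (b : R[i]).

(* z = vcoord z - ycoord z * conj b *)
Definition ycoord (z : R[i]) : R := complex.Im z / complex.Im b.
Definition vcoord (z : R[i]) : R := complex.Re z + complex.Re b * ycoord z.

Hypothesis b_nreal : complex.Im b != 0.

Lemma ycoordB x y : ycoord (x - y) = ycoord x - ycoord y.
Proof. by rewrite /ycoord raddfB mulrBl. Qed.

Lemma vcoordB x y : vcoord (x - y) = vcoord x - vcoord y.
Proof. by rewrite /vcoord ycoordB raddfB; ring. Qed.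

Lemma ycoord_int (m : int) : ycoord m%:~R = 0.
Proof. by rewrite /ycoord -(rmorph_int (real_complex R)) /= mul0r. Qed.

Lemma vcoord_int (m : int) : vcoord m%:~R = m%:~R.
Proof.
by rewrite /vcoord ycoord_int -(rmorph_int (real_complex R)) /= mulr0 addr0.
Qed.

(** With [z = v - y * conj b] and [b = s - conj b], one gets [b * z = v * b - n * y = (s * v - n *
    y) - v * conj b]; both coordinates of [b * z] can be read off. *)
Lemma ycoordM z : ycoord (b * z) = vcoord z.
Proof.
by move: b_nreal; rewrite /vcoord /ycoord; case: b z => p q [u v] /= q0; field.
Qed.

Lemma vcoordM z : vcoord (b * z) =
  2 * complex.Re b * vcoord z
    - (complex.Re b ^+ 2 + complex.Im b ^+ 2) * ycoord z.
Proof.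
rewrite {1}/vcoord ycoordM /vcoord /ycoord.
by move: b_nreal; case: b z => p q [u v] /= q0; field.
Qed.

(** Both coordinates are real-linear, so one Lipschitz constant converts the radius of a disk into a
    bound on how far each coordinate moves. *)
Lemma coord_lip : exists2 K : R, 0 < K & forall z e, `|z| < e%:C ->
  `|ycoord z| <= K * e /\ `|vcoord z| <= K * e.
Proof.
set k := `|complex.Im b|^-1; set r := `|complex.Re b|.
have k0 : 0 <= k by rewrite invr_ge0.
have r0 : 0 <= r by exact: normr_ge0.
have rk0 : 0 <= r * k by exact: mulr_ge0.
(* [k] suffices for [ycoord] and [1 + r * k] for [vcoord]; the sum serves both and is positive. *)
exists (1 + k + r * k) => [|z e ze]; first lra.
have Ree : `|complex.Re z| <= e.
  by rewrite -lecR (le_trans (normc_ge_Re z))// ltW.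
have Ime : `|complex.Im z| <= e.
  by rewrite -lecR (le_trans (normc_ge_Im z))// ltW.
have e0 : 0 <= e by exact: le_trans Ree.
have yE : `|ycoord z| <= k * e.
  by rewrite /ycoord normrM normfV mulrC ler_wpM2l.
have ke0 := mulr_ge0 k0 e0; have rke0 := mulr_ge0 rk0 e0.
split; first by rewrite !mulrDl; lra.
apply: (le_trans (ler_normD _ _)); rewrite normrM -/r.
have : r * `|ycoord z| <= r * (k * e) by rewrite ler_wpM2l.
by rewrite !mulrDl mulrA; lra.
Qed.

Definition parallelogram (p q : R) : set R[i] :=
  [set z | `|vcoord z| <= p /\ `|ycoord z| <= q].

Lemma bounded_parallelogram p q :
  bounded_set (parallelogram p q : set R[i]^o).
Proof.
apply/bounded_setC.
exists (p + `|complex.Re b| * q + `|complex.Im b| * q) => z [vp yq].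
apply: (le_trans (normc_le_ReIm z)); rewrite lecR.
have -> : complex.Re z = vcoord z - complex.Re b * ycoord z.
  by rewrite /vcoord; ring.
have -> : complex.Im z = complex.Im b * ycoord z.
  by rewrite /ycoord mulrC divfK.
rewrite lerD//; last by rewrite normrM ler_wpM2l.
by rewrite (le_trans (ler_normB _ _))// lerD// normrM ler_wpM2l.
Qed.

Lemma OL_parallelogram (M : nat) :
  complex.Re b ^+ 2 + complex.Im b ^+ 2 + `|2 * complex.Re b|
    < (2 * M + 1)%:R ->
  OL_property b (digits R M).
Proof.
(* [n] is [b * conj b]; [s] is here the absolute value of the trace [b + conj b]. *)
set n := _ + _ ^+ 2; set s := `|2 * _|; rewrite natrD natrM => nsM.
have n0 : 0 <= n by rewrite addr_ge0 ?sqr_ge0.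
have s0 : 0 <= s by exact: normr_ge0.
have vM w : vcoord (b * w) = 2 * complex.Re b * vcoord w - n * ycoord w.
  exact: vcoordM.
clearbody n.
have [K K0 Klip] := coord_lip.
(* [d] solves [s * p + n * q + d = M + 1/2] for the half-widths [p], [q] below, and [D] is the
   coefficient of [d] in it. A disk will use only [d / 2] of the last summand, which makes the bound
   [vx] strict. *)
pose D := s + 2 * n + 1; have D0 : 0 < D by rewrite /D; lra.
pose d := (2 * M%:R + 1 - n - s) / (2 * D).
have d0 : 0 < d by rewrite divr_gt0//; lra.
have dD : d * s + 2 * (d * n) + d = M%:R + 2^-1 - 2^-1 * n - 2^-1 * s.
  have dDE : d * D = (2 * M%:R + 1 - n - s) / 2.
    by rewrite /d; field; rewrite lt0r_neq0.
  by move: dDE; rewrite /D !mulrDr mulr1 [d * (2 * n)]mulrCA; lra.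
pose e := d / (2 * K).
have e0 : 0 < e by rewrite divr_gt0// mulr_gt0.
have Ke : K * e = d / 2 by rewrite /e; field; rewrite lt0r_neq0.
(* Two disks separate [b * w] from [x'], each moving a coordinate by at most [K * e = d / 2]. Since
   [ycoord (b * w)] is [vcoord w], this requires [q = p + d]. Rounding is done at [x], so [vcoord]
   only needs [1/2 + d / 2 <= p]. *)
pose p := 2^-1 + d; pose q := 2^-1 + 2 * d.
exists e, (parallelogram p q); split => //.
- exact: bounded_parallelogram.
- exists 0; rewrite /parallelogram /= -[0]/(0%:~R) vcoord_int ycoord_int normr0.
  by rewrite /p /q; lra.
move=> x [_ [w [vw yw] <-] /in_disk /Klip[]].
rewrite Ke ycoordB vcoordB ycoordM vM => ydx vdx.
have vx : `|vcoord x| < M%:R + 2^-1.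
  have sv : `|2 * complex.Re b * vcoord w| <= s * p.
    by rewrite normrM ler_wpM2l.
  have ny : `|n * ycoord w| <= n * q.
    by rewrite normrM (ger0_norm n0) ler_wpM2l.
  move: sv ny vdx.
  rewrite /p /q !mulrDr [n * (2 * d)]mulrCA ![_ * d]mulrC.
  rewrite !ler_norml ltr_norml => /andP[? ?] /andP[? ?] /andP[? ?].
  by apply/andP; split; lra.
have [m mM xm] := nearest_int vx.
exists m%:~R; first by apply/in_digits; exists m.
move=> x' /in_disk /Klip[]; rewrite Ke ycoordB vcoordB => ydx' vdx'.
exists (x' - m%:~R); last by rewrite subrK.
split; rewrite ?vcoordB ?ycoordB ?vcoord_int ?ycoord_int.
  move: xm vdx'; rewrite /p !ler_norml => /andP[? ?] /andP[? ?].
  by apply/andP; split; lra.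
move: vw ydx ydx'; rewrite /p /q !ler_norml.
by move=> /andP[? ?] /andP[? ?] /andP[? ?]; apply/andP; split; lra.
Qed.

End Coordinates.

Theorem theorem20 (R : realType) (beta : R[i]) (M : nat) :
  beta \isn't Num.real ->
  1 < `|beta| ->
  beta * Num.conj beta + `|beta + Num.conj beta| < #|` digits R M|%:R ->
  OL_property beta (digits R M).
Proof.
(* Both sides of the hypothesis are rewritten as images of real numbers, so that the inequality
   descends from [R[i]] to [R]. *)
move=> beta_nreal _; rewrite -normCK -add_Re2_Im2 conjCE addcJ card_digits.
rewrite -(rmorph_nat (real_complex R) 2) -rmorphM normc_def /= expr0n addr0.
rewrite sqrtr_sqr -rmorphD -(rmorph_nat (real_complex R)) ltcR => nsM.
apply: OL_parallelogram nsM.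
by case: beta beta_nreal => a b; rewrite complex_real.
Qed.
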